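(* Let $N\ge1$ be an integer. The expected time until absorption $m_i$ when starting in $i$ ($i=0,1,\dots,N$) in a $[pqrs]$ random walk on $[0,N]$, with absorbing barriers $0$ and $N$, is $$m_i=\frac1s\left\{\frac{(1-\xi_1^{N-i})(1-\xi_2^N)-(1-\xi_2^{N-i})(1-\xi_1^N)}{\xi_1^N-\xi_2^N}\right\}.$$
   Context: Let $p,q,s>0$, $r\ge0$ with $p+q+r+s=1$. A $[pqrs]$ random walk on an interval of integers: in each state $n$ that is not an absorbing barrier, at each time unit the walk moves to $n+1$ with probability $p$, moves to $n-1$ with probability $q$, stays in $n$ for a time unit with probability $r$, and with probability $s$ is absorbed in the current state $n$ (the process terminates there). When the walk reaches an absorbing barrier it is absorbed there. Each action (step, stay, or absorption in the current non-barrier state) takes one time unit; the time until absorption is the number of time units until the process terminates, and is $0$ when starting in a barrier. Notation: $$\xi_1=\frac{(1-r)+\sqrt{(1-r)^2-4pq}}{2q},\quad \xi_2=\frac{(1-r)-\sqrt{(1-r)^2-4pq}}{2q}.$$ *)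

(* Defs.v *)
From HB Require Import structures.
From mathcomp Require Import all_boot all_order all_algebra.
From mathcomp Require Import all_classical all_reals all_analysis.

Set Implicit Arguments.
Unset Strict Implicit.
Unset Printing Implicit Defensive.

Import Order.TTheory GRing.Theory Num.Theory.

Local Open Scope classical_set_scope.
Local Open Scope ring_scope.

(* State of a walk on [0, N]: the current position, and whether the walk has
   been absorbed (with probability s) in that position. *)
Definition state (N : nat) : Type := ('I_N.+1 * bool)%type.

Definition barrier (N : nat) (k : 'I_N.+1) : bool :=
  (k == 0%N :> nat) || (k == N :> nat).

Definition absorbed (N : nat) (x : state N) : bool := x.2 || barrier x.1.

(* One-step transition probability from x to y. The process stays forever in
   the state in which it terminates. *)
Definition trans (R : realType) (p q r s : R) (N : nat) (x y : state N) : R :=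
  if absorbed x then (y == x)%:R
  else if y.2 then (if y.1 == x.1 then s else 0)
  else if y.1 == x.1.+1 :> nat then p
  else if y.1.+1 == x.1 :> nat then q
  else if y.1 == x.1 then r
  else 0.

Definition path_event (T : Type) (N : nat) (X : nat -> T -> state N)
    (n : nat) (x : nat -> state N) : set T :=
  [set w | forall k, (k <= n)%N -> X k w = x k].

(* X is a [pqrs] random walk on [0, N], with absorbing barriers 0 and N,
   starting in i. The last field is the time-homogeneous Markov property
   P(X_{n+1} = x_{n+1} | X_0 = x_0, ..., X_n = x_n) = trans x_n x_{n+1},
   multiplied out so that null conditioning events need no separate treatment.
   The initial flag is false even when i
   is a barrier: barrier positions count as [absorbed] whatever their flag. *)
Record pqrs_walk (R : realType) (p q r s : R) (N : nat) (i : 'I_N.+1)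
    (d : measure_display) (T : measurableType d) (P : probability T R)
    (X : nat -> T -> state N) : Prop := PqrsWalk {
  walk_measurable : forall n x, measurable [set w | X n w = x] ;
  walk_start : P [set w | X 0%N w = (i, false)] = 1%E ;
  walk_step : forall n (x : nat -> state N),
    P (path_event X n.+1 x) =
    (P (path_event X n x) * (trans p q r s (x n) (x n.+1))%:E)%E
}.

(* The infimum of the empty set is +oo: a path that is never absorbed has an
   infinite absorption time. *)
Definition absorption_time (R : realType) (T : Type) (N : nat)
    (X : nat -> T -> state N) (w : T) : \bar R :=
  ereal_inf [set (n%:R)%:E | n in [set n : nat | absorbed (X n w)]].

Definition expected_absorption_time (R : realType) (d : measure_display)
    (T : measurableType d) (P : probability T R) (N : nat)
    (X : nat -> T -> state N) : \bar R :=
  (\int[P]_w absorption_time R X w)%E.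

Definition xi1 (R : realType) (p q r : R) : R :=
  ((1 - r) + Num.sqrt ((1 - r) ^+ 2 - 4 * p * q)) / (2 * q).

Definition xi2 (R : realType) (p q r : R) : R :=
  ((1 - r) - Num.sqrt ((1 - r) ^+ 2 - 4 * p * q)) / (2 * q).

(* Main.v *)
Require Import Defs.
From HB Require Import structures.
From mathcomp Require Import all_boot all_order all_algebra.
From mathcomp Require Import all_classical all_reals all_analysis.
From mathcomp Require Import measurable_realfun ring lra zify.

Set Implicit Arguments.
Unset Strict Implicit.
Unset Printing Implicit Defensive.

Import Order.TTheory GRing.Theory Num.Theory.

Local Open Scope classical_set_scope.
Local Open Scope ring_scope.

(** Call a walk alive through time n if none of its states up to n is absorbed.
    The absorption time is the number of times through which it is alive, so
    its mean is the series of the probabilities a_n of being alive through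
    time n ([absorption_time_series]).

    These probabilities are summed by a potential argument. Let m be the
    claimed closed form, as a function of the position. It vanishes at both
    barriers and solves the first-step equation
      p m(k+1) + q m(k-1) + r m(k) = m(k) - 1
    in between ([mean_time_first_step]): the constant 1/s is a particular
    solution, and k |-> x^(N-k) solves the homogeneous equation when x
    is a root of q x^2 - (1-r) x + p, that is when x is x1 or x2. Let u_n be
    the mean of m(X_n) on the event that the walk is alive through n. The
    Markov property and the first-step equation give u_(n+1) = u_n - a_n
    ([alive_meanS], [sum_prob_alive]), and u_0 = m(i), whence
      a_0 + ... + a_(n-1) = m(i) - u_n.
    At each step an alive walk survives with probability at most
    p + q + r = 1 - s, so a_n <= (1-s)^n, and u_n, whose absolute value is at
    most a constant times a_n, tends to 0.

    The walk is only known through the probabilities of full trajectories.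
    The one-step recursion for the alive walk requires the Markov property for
    the coarser history of having been alive so far; [history_step] obtains
    it by summing out the trajectory one coordinate at a time. *)

(** * The closed form and the first-step equation *)

Section ClosedForm.
Variables (R : realType) (p q r s : R).
Hypotheses (p_gt0 : 0 < p) (q_gt0 : 0 < q) (s_gt0 : 0 < s) (r_ge0 : 0 <= r).
Hypothesis pqrs1 : p + q + r + s = 1.

Local Notation x1 := (xi1 p q r).
Local Notation x2 := (xi2 p q r).

Ltac params_lra :=
  move: p_gt0 q_gt0 s_gt0 r_ge0 pqrs1 => *; lra.

(** Positivity of s is what separates the two roots: for s = r = 0 and p = q
    the discriminant vanishes. *)
Lemma discriminant_gt0 : 0 < (1 - r) ^+ 2 - 4 * p * q.
Proof.
have -> : (1 - r) ^+ 2 - 4 * p * q = (p - q) ^+ 2 + s * (2 * (p + q) + s).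
  have -> : 1 - r = p + q + s by params_lra.
  ring.
apply: ltr_wpDl; first exact: sqr_ge0.
by rewrite mulr_gt0 //; params_lra.
Qed.

Lemma quadratic_formula D : D ^+ 2 = (1 - r) ^+ 2 - 4 * p * q ->
  let x := ((1 - r) + D) / (2 * q) in q * x ^+ 2 + p = (1 - r) * x.
Proof.
move=> DD /=; have q0 : q != 0 by rewrite gt_eqF.
have -> : p = ((1 - r) ^+ 2 - D ^+ 2) / (4 * q) by rewrite DD; field.
by field.
Qed.

Lemma xi1_root : q * x1 ^+ 2 + p = (1 - r) * x1.
Proof. by apply: quadratic_formula; apply/sqr_sqrtr/ltW/discriminant_gt0. Qed.

Lemma xi2_root : q * x2 ^+ 2 + p = (1 - r) * x2.
Proof.
apply: quadratic_formula; rewrite sqrrN.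
exact/sqr_sqrtr/ltW/discriminant_gt0.
Qed.

(** The exponents decrease as the position increases, because the closed form
    is written in powers of the distance to the upper barrier: the powers
    below are those at positions k+1, k-1 and k when j = N - k - 1. *)
Lemma root_pow_harmonic x j : q * x ^+ 2 + p = (1 - r) * x ->
  p * x ^+ j + q * x ^+ j.+2 + r * x ^+ j.+1 = x ^+ j.+1.
Proof. by move=> xroot; rewrite !exprS; move: (x ^+ j) => y; nra. Qed.

(** For N > 0 this makes the denominator of the closed form nonzero: the
    discriminant is positive and both roots are nonnegative, so x2 < x1
    survives raising to the N-th power. *)
Lemma xi_pow_neq N : (1 <= N)%N -> x1 ^+ N != x2 ^+ N.
Proof.
move=> N1.
have D0 : 0 < Num.sqrt ((1 - r) ^+ 2 - 4 * p * q) by rewrite sqrtr_gt0 discriminant_gt0.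
have x21 : x2 < x1.
  by rewrite /xi1 /xi2 ltr_pM2r ?invr_gt0 ?mulr_gt0 //; params_lra.
have x2_ge0 : 0 <= x2.
  rewrite /xi2 mulr_ge0 ?invr_ge0 ?mulr_ge0 ?(ltW q_gt0) // subr_ge0.
  have r1 : 0 <= 1 - r by params_lra.
  rewrite -[leRHS](ger0_norm r1) -sqrtr_sqr ler_wsqrtr // gerBl.
  by rewrite !mulr_ge0 ?(ltW p_gt0) ?(ltW q_gt0).
by rewrite gt_eqF // ltrXn2r // -lt0n.
Qed.

Definition mean_time N k : R :=
  s^-1 * (((1 - x1 ^+ (N - k)) * (1 - x2 ^+ N)
            - (1 - x2 ^+ (N - k)) * (1 - x1 ^+ N))
           / (x1 ^+ N - x2 ^+ N)).

Lemma mean_time0 N : mean_time N 0 = 0.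
Proof.
rewrite /mean_time subn0 [X in X - _]mulrC.
by rewrite subrr mul0r mulr0.
Qed.

Lemma mean_timeN N : mean_time N N = 0.
Proof. by rewrite /mean_time subnn !expr0 subrr !mul0r subrr mul0r mulr0. Qed.

Lemma mean_time_first_step N k : (0 < k < N)%N ->
  p * mean_time N k.+1 + q * mean_time N k.-1 + r * mean_time N k =
  mean_time N k - 1.
Proof.
case: k => // k /andP[_ kN] /=.
have Nn : x1 ^+ N - x2 ^+ N != 0.
  by rewrite subr_eq0 xi_pow_neq //; apply: leq_trans kN.
have [j jE] : exists j, N = (j + k.+2)%N by exists (N - k.+2)%N; rewrite subnK.
rewrite /mean_time.
have -> : (N - k.+2 = j)%N by lia.
have -> : (N - k = j.+2)%N by lia.
have -> : (N - k.+1 = j.+1)%N by lia.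
have s0 : s != 0 by rewrite gt_eqF.
have f1 := root_pow_harmonic j xi1_root.
have f2 := root_pow_harmonic j xi2_root.
move: Nn; move: (x1 ^+ N) (x2 ^+ N) => A B AB.
(* The first-step operator is linear, so it can be moved onto the powers of
   each root separately, where it acts as the identity. *)
have -> : p * (s^-1 * (((1 - x1 ^+ j) * (1 - B) - (1 - x2 ^+ j) * (1 - A)) / (A - B)))
  + q * (s^-1 * (((1 - x1 ^+ j.+2) * (1 - B) - (1 - x2 ^+ j.+2) * (1 - A)) / (A - B)))
  + r * (s^-1 * (((1 - x1 ^+ j.+1) * (1 - B) - (1 - x2 ^+ j.+1) * (1 - A)) / (A - B)))
  = s^-1 * (((p + q + r - (p * x1 ^+ j + q * x1 ^+ j.+2 + r * x1 ^+ j.+1)) * (1 - B)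
     - (p + q + r - (p * x2 ^+ j + q * x2 ^+ j.+2 + r * x2 ^+ j.+1)) * (1 - A)) / (A - B)).
  by field; rewrite AB.
have -> : p + q + r = 1 - s by params_lra.
by rewrite f1 f2; field; rewrite AB.
Qed.

End ClosedForm.

(** * One step of the walk *)

Section FirstStep.
Variables (R : realType) (p q r s : R) (N : nat).

(** A flagged state has terminated, and a function of the position is lifted
    as a time still to elapse: it is 0 there, whatever the position. *)
Definition lift_position (f : nat -> R) (x : state N) : R :=
  if x.2 then 0 else f x.1.

Lemma sum_ord_eq (f : nat -> R) j : (j < N.+1)%N ->
  \sum_(k < N.+1) (k == j :> nat)%:R * f k = f j.
Proof.
move=> jN; rewrite (bigD1 (Ordinal jN)) //= eqxx mul1r big1 ?addr0 // => k kj.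
by have /negbTE -> : k != j :> nat := kj; rewrite mul0r.
Qed.

(** The s-transition does not appear on the right because it leads to flagged
    states, where lifted functions vanish. *)
Lemma trans_lift_position (x : state N) (f : nat -> R) : ~~ absorbed x ->
  \sum_y trans p q r s x y * lift_position f y =
  p * f x.1.+1 + q * f x.1.-1 + r * f x.1.
Proof.
move=> ax; have := ax; rewrite negb_or => /andP[_]; rewrite negb_or => /andP[x0 xN].
have xlt : (x.1 < N)%N by rewrite ltn_neqAle xN -ltnS ltn_ord.
have xgt : (0 < x.1)%N by rewrite lt0n.
rewrite -(pair_bigA _ (fun k b => trans p q r s x (k, b) * lift_position f (k, b))) /=.
transitivity (\sum_(k < N.+1) (p * ((k == x.1.+1 :> nat)%:R * f k)
   + q * ((k == x.1.-1 :> nat)%:R * f k) + r * ((k == x.1 :> nat)%:R * f k))).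
  apply: eq_bigr => k _; rewrite big_bool /lift_position /= mulr0 add0r.
  rewrite /trans (negbTE ax) /=.
  have -> : (k == x.1) = (k == x.1 :> nat) by [].
  have -> : (k == x.1.-1 :> nat) = (k.+1 == x.1 :> nat).
    by rewrite -{2}(prednK xgt) eqSS.
  have [e1|_] := eqVneq (k : nat) x.1.+1.
    have /negbTE -> : k.+1 != x.1 :> nat by lia.
    have /negbTE -> : (k : nat) != x.1 :> nat by lia.
    by rewrite !mul0r !mulr0 !addr0 mul1r.
  have [e2|_] := eqVneq k.+1 x.1.
    have /negbTE -> : (k : nat) != x.1 :> nat by lia.
    by rewrite !mul0r !mulr0 addr0 add0r mul1r.
  by case: eqVneq => _; rewrite ?mul0r ?mulr0 ?add0r ?mul1r.
rewrite !big_split -!mulr_sumr !sum_ord_eq //.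
exact: leq_ltn_trans (leq_pred _) (ltn_ord _).
Qed.

End FirstStep.

(** * Measures along a finite-valued map *)

Section FiniteValued.
Variables (d : measure_display) (T : measurableType d) (R : realType).
Variables (mu : {measure set T -> \bar R}) (I : finType) (f : T -> I).
Hypothesis mf : forall z, measurable [set w | f w = z].

(** This is the form of total probability used both to sum out a coordinate of
    the trajectory and to split an event over the present state. *)
Lemma measure_sum_fibers (A : set T) : measurable A ->
  mu A = (\sum_z mu (A `&` [set w | f w = z]))%E.
Proof.
move=> mA.
have AE : \bigcup_(z in [set` index_enum I]) (A `&` [set w | f w = z]) = A.
  apply/seteqP; split=> [w [z _ []]//|w Aw].
  by exists (f w) => //=; exact: mem_index_enum.
rewrite -{1}AE measure_fin_bigcup; first by rewrite -fsbig_seq //; exact: index_enum_uniq.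
- exact: finite_seq.
- by move=> z1 z2 _ _ [w [[_ <-] [_ <-]]].
- by move=> z _; apply: measurableI.
Qed.

End FiniteValued.

(** * The absorption time as a series of indicators *)

Section AbsorptionTime.
Variables (R : realType) (T : Type) (N : nat) (X : nat -> T -> state N).

Definition alive_through n : set T :=
  [set w | forall k, (k <= n)%N -> ~~ absorbed (X k w)].

(** This holds at every sample point, including those of the null event that
    the walk leaves an absorbed state: being alive through n refers to all
    times up to n. *)
Lemma absorption_time_series w :
  absorption_time R X w =
  (\sum_(n <oo) (\1_(alive_through n) w : R)%:E)%E.
Proof.
have [[n0 an0]|never] := pselect (exists n, absorbed (X n w)).
  have ex : exists n, absorbed (X n w) by exists n0.
  case: (ex_minnP ex) => m am mmin.
  have -> : absorption_time R X w = m%:R%:E.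
    apply/eqP; rewrite eq_le; apply/andP; split.
      by apply: ereal_inf_lbound; exists m.
    apply: le_ereal_inf_tmp => _ [n /= an <-].
    by rewrite lee_fin ler_nat; exact: mmin.
  rewrite (@nneseries_split _ _ 0 m); last by move=> k _; rewrite lee_fin.
  rewrite add0n eseries0 ?adde0 => [|k mk _]; last first.
    rewrite indicE memNset // => /(_ m mk); by rewrite am.
  rewrite (eq_big_nat _ _ (F2 := fun=> 1%E)) => [|k /andP[_ km]].
    by rewrite sumEFin sumr_const_nat subn0.
  rewrite indicE mem_set // => j jk; apply/negP => /mmin; lia.
have alive k : alive_through k w by move=> j _; apply/negP => aj; apply: never; exists j.
transitivity (+oo%E : \bar R).
  rewrite /absorption_time (_ : [set _ | n in _] = set0) ?ereal_inf0 //.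
  by apply/seteqP; split=> // _ [n /= an _]; apply: never; exists n.
apply/esym/cvg_lim => //.
under eq_fun do under eq_bigr do rewrite indicE mem_set //.
under eq_fun do rewrite sumEFin sumr_const_nat subn0.
apply/cvgeryP; exact: cvgr_idn.
Qed.

End AbsorptionTime.

(** * The Markov property of the alive walk *)

Section Walk.
Variables (R : realType) (p q r s : R) (N : nat) (i : 'I_N.+1).
Variables (d : measure_display) (T : measurableType d) (P : probability T R).
Variables (X : nat -> T -> state N).
Hypothesis walkX : pqrs_walk p q r s i P X.

Let mX := walk_measurable walkX.

Lemma measurable_preimage n (D : pred (state N)) :
  measurable [set w | D (X n w)].
Proof.
have -> : [set w | D (X n w)] = \bigcup_(x in [set` D]) [set w | X n w = x].
  by apply/seteqP; split=> [w Dw|w [x Dx /= ->]//]; exists (X n w).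
by apply: fin_bigcup_measurable => // x _; exact: mX.
Qed.

Section History.
Variable D : pred (state N).

(** A history between the two extremes needed: for k = 0 it is a full
    trajectory up to n, and for k = n it records the present state and, about
    the past, only that it stayed in D. *)
Definition history k n (x : nat -> state N) : set T :=
  [set w | (forall j, (j < k)%N -> D (X j w)) /\
           (forall j, (k <= j <= n)%N -> X j w = x j)].

Lemma measurable_history k n x : measurable (history k n x).
Proof.
have -> : history k n x =
    (\bigcap_(j in [set j | (j < k)%N]) [set w | D (X j w)]) `&`
    (\bigcap_(j in [set j | (k <= j <= n)%N]) [set w | X j w = x j]).
  by apply/seteqP; split=> w [h1 h2]; split.
apply: measurableI; apply: bigcap_measurableType => j _; last exact: mX.
exact: measurable_preimage.
Qed.

Lemma history_marginal k n x : (k <= n)%N ->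
  P (history k.+1 n x) =
  (\sum_(z | D z) P (history k n (fun j => if j == k then z else x j)))%E.
Proof.
move=> kn; rewrite (measure_sum_fibers _ (mX k) (measurable_history _ _ _)).
rewrite [RHS]big_mkcond; apply: eq_bigr => z _; case: ifPn => Dz; last first.
  rewrite (_ : _ `&` _ = set0) ?measure0 //.
  apply/seteqP; split=> // w [[/(_ k (ltnSn k)) + _] /= Xz].
  by rewrite Xz (negbTE Dz).
congr (P _); apply/seteqP; split=> w /=.
  move=> [[h1 h2] Xz]; split=> [j jk|j /andP[kj jn]].
    by apply: h1; apply: ltnW.
  have [->//|njk] := eqVneq j k; apply: h2.
  by rewrite jn ltn_neqAle eq_sym njk kj.
move=> [h1 h2]; have Xz : X k w = z by rewrite h2 ?eqxx // leqnn kn.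
split=> //; split=> [j|j /andP[kj jn]].
  by rewrite ltnS leq_eqVlt => /predU1P[->|/h1//]; rewrite Xz.
by rewrite h2 ?jn ?(ltnW kj) // gtn_eqF.
Qed.

(** Each induction step sums out the coordinate k over D. Since k < n, the
    transition probability does not depend on it and factors out. *)
Lemma history_step k n x : (k <= n)%N ->
  P (history k n.+1 x) =
  (P (history k n x) * (trans p q r s (x n) (x n.+1))%:E)%E.
Proof.
elim: k x => [|k IHk] x kn.
  have hE m : history 0 m x = path_event X m x.
    by apply/seteqP; split=> w /=; [case=> _ h j jm; exact: h | move=> h; split].
  by rewrite !hE (walk_step walkX).
rewrite !history_marginal ?(ltnW kn) ?ltnS ?(ltnW (ltnW kn)) //; last first.
  by rewrite leqW // ltnW.
rewrite ge0_sume_distrl //; apply: eq_bigr => z _.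
by rewrite IHk ?(ltnW kn) // !gtn_eqF // ltnW.
Qed.

End History.

Lemma measurable_alive n : measurable (alive_through X n).
Proof.
have -> : alive_through X n = \bigcap_(k in [set k | (k <= n)%N])
    [set w | ~~ absorbed (X k w)] by [].
by apply: bigcap_measurableType => k _; exact: (measurable_preimage _ (predC _)).
Qed.

(** The sub-probability law of the walk killed at absorption. *)
Definition alive_law n (x : state N) : R :=
  fine (P (alive_through X n `&` [set w | X n w = x])).

Lemma alive_law_ge0 n x : 0 <= alive_law n x.
Proof. exact: fine_ge0. Qed.

Lemma alive_law_absorbed n x : absorbed x -> alive_law n x = 0.
Proof.
move=> ax; rewrite /alive_law (_ : _ `&` _ = set0) ?measure0 //.
apply/seteqP; split=> // w [/(_ n (leqnn n)) + /= Xx].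
by rewrite Xx ax.
Qed.

Lemma prob_alive n : P (alive_through X n) = (\sum_x alive_law n x)%:E.
Proof.
rewrite (measure_sum_fibers _ (mX n) (measurable_alive n)) -sumEFin.
apply: eq_bigr => x _; rewrite fineK // fin_num_measure //.
by apply: measurableI => //; exact: measurable_alive.
Qed.

(** Both sides are split over the state at time n. For the pieces where that
    state is alive, being alive through n+1 and at y is a history of the kind
    for which the Markov property is known; the other pieces are empty. *)
Lemma alive_lawS n y : ~~ absorbed y ->
  alive_law n.+1 y = \sum_x alive_law n x * trans p q r s x y.
Proof.
move=> ay; apply: EFin_inj.
have mB : measurable (alive_through X n.+1 `&` [set w | X n.+1 w = y]).
  by apply: measurableI => //; exact: measurable_alive.
rewrite fineK ?fin_num_measure // (measure_sum_fibers _ (mX n) mB) -sumEFin.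
apply: eq_bigr => x _; rewrite EFinM fineK; last first.
  by rewrite fin_num_measure //; apply: measurableI => //; exact: measurable_alive.
have [ax|ax] := boolP (absorbed x).
  have disj (A : set T) : A `<=` alive_through X n ->
      A `&` [set w | X n w = x] = set0.
    move=> An; apply/seteqP; split=> // w [/An/(_ n (leqnn n)) + /= Xx].
    by rewrite Xx ax.
  rewrite !disj ?measure0 ?mul0e // => w [h _] k kn.
  exact/h/leqW.
pose path j := if j == n.+1 then y else x.
have pathS : path n.+1 = y by rewrite /path eqxx.
have pathn : path n = x by rewrite /path ltn_eqF.
have := @history_step (predC (@absorbed N)) n n path (leqnn n).
rewrite pathS pathn => hst.
rewrite (_ : alive_through X n `&` _ = history (predC (@absorbed N)) n n path).
  rewrite -hst; congr (P _); apply/seteqP; split=> w.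
    move=> [[h1 h2] h3]; split=> j; first by move=> jn; apply: h1; lia.
    move=> /andP[nj]; rewrite leq_eqVlt => /predU1P[->|jn]; first by rewrite pathS.
    have -> : j = n by lia.
    by rewrite pathn; exact: h3.
  move=> [h1 h2].
  have e1 : X n w = x by rewrite h2 ?pathn ?leqnn ?leqnSn.
  have e2 : X n.+1 w = y by rewrite h2 ?pathS ?leqnn ?leqnSn.
  split=> //; split=> // j.
  rewrite leq_eqVlt => /predU1P[->|]; first by rewrite e2.
  by rewrite ltnS leq_eqVlt => /predU1P[->|/h1//]; rewrite e1.
apply/seteqP; split=> w.
  move=> [h1 h2]; split=> j; first by move=> jn; apply: h1; lia.
  by rewrite -eqn_leq => /eqP <-; rewrite pathn.
move=> [h1 h2]; have e1 : X n w = x by rewrite h2 ?pathn ?leqnn.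
split=> // j.
by rewrite leq_eqVlt => /predU1P[->|/h1//]; rewrite e1.
Qed.

Lemma alive_law0 x : ~~ absorbed x -> alive_law 0 x = (x == (i, false))%:R.
Proof.
move=> ax; rewrite /alive_law.
rewrite (_ : _ `&` _ = [set w | X 0%N w = x]); last first.
  apply/seteqP; split=> w; first by case.
  by move=> /= Xx; split=> // k; rewrite leqn0 => /eqP ->; rewrite Xx.
have [->|xi] := eqVneq x (i, false); first by rewrite (walk_start walkX).
rewrite (_ : P _ = 0%E) //; apply/eqP; rewrite -measure_le0.
have <- : P (~` [set w | X 0%N w = (i, false)]) = 0%E.
  by rewrite probability_setC // (walk_start walkX) subee.
apply: le_measure; rewrite ?inE //; first exact: measurableC.
by move=> w /= ->; apply/eqP.
Qed.

(** * Means over the alive walk *)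

Definition alive_mean n (f : nat -> R) : R :=
  \sum_x alive_law n x * lift_position f x.

Definition vanishing_at_barriers (f : nat -> R) := (f 0 = 0) /\ (f N = 0).

Lemma lift_position_absorbed f (x : state N) : vanishing_at_barriers f ->
  absorbed x -> lift_position f x = 0.
Proof.
move=> [f0 fN]; rewrite /absorbed /barrier /lift_position.
by case: x.2 => //= /orP[/eqP ->|/eqP ->].
Qed.

Lemma alive_mean0 f : vanishing_at_barriers f -> alive_mean 0 f = f i.
Proof.
move=> fb; rewrite /alive_mean (bigD1 (i, false)) //= big1 => [|x xi].
  have [ax|ax] := boolP (absorbed ((i, false) : state N)).
    have := lift_position_absorbed fb ax.
    by rewrite /lift_position /= => ->; rewrite mulr0 addr0.
  by rewrite alive_law0 // eqxx mul1r addr0.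
have [ax|ax] := boolP (absorbed x); first by rewrite alive_law_absorbed // mul0r.
by rewrite alive_law0 // (negbTE xi) mul0r.
Qed.

(** Vanishing at the barriers makes the mean over the alive walk at time n+1
    agree with the mean over every state that the walk alive through n can
    reach. *)
Lemma alive_meanS n f : vanishing_at_barriers f ->
  alive_mean n.+1 f =
  alive_mean n (fun k => p * f k.+1 + q * f k.-1 + r * f k).
Proof.
move=> fb; rewrite /alive_mean.
under eq_bigr => y _.
  rewrite (_ : _ * _ =
      \sum_x alive_law n x * trans p q r s x y * lift_position f y); last first.
    rewrite -mulr_suml.
    have [ay|ay] := boolP (absorbed y); last by rewrite alive_lawS.
    by rewrite (lift_position_absorbed fb ay) !mulr0.
  over.
rewrite exchange_big; apply: eq_bigr => x _ /=.
under eq_bigr do rewrite -mulrA.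
rewrite -mulr_sumr.
have [ax|ax] := boolP (absorbed x); first by rewrite alive_law_absorbed // !mul0r.
rewrite trans_lift_position // /lift_position.
by move: ax; rewrite /absorbed; case: x.2.
Qed.

Lemma eq_alive_mean n f g : (forall k, (0 < k < N)%N -> f k = g k) ->
  alive_mean n f = alive_mean n g.
Proof.
move=> fg; apply: eq_bigr => x _.
have [ax|] := boolP (absorbed x); first by rewrite alive_law_absorbed // !mul0r.
rewrite /lift_position; case: ifP => // _.
rewrite negb_or => /andP[_]; rewrite negb_or => /andP[x0 xN].
by rewrite fg // lt0n x0 ltn_neqAle xN -ltnS ltn_ord.
Qed.

End Walk.

(** * Summation of the survival probabilities *)

Section ExpectedTime.
Variables (R : realType) (p q r s : R).
Hypotheses (p_gt0 : 0 < p) (q_gt0 : 0 < q) (s_gt0 : 0 < s) (r_ge0 : 0 <= r).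
Hypothesis pqrs1 : p + q + r + s = 1.
Variables (N : nat) (i : 'I_N.+1).
Variables (d : measure_display) (T : measurableType d) (P : probability T R).
Variables (X : nat -> T -> state N).
Hypothesis walkX : pqrs_walk p q r s i P X.

Local Notation a n := (\sum_x alive_law P X n x).
Local Notation m := (mean_time p q r s N).

(** Being alive is the mean of the indicator f of the interior, which vanishes
    at the barriers; one step multiplies it by at most p + q + r. *)
Lemma prob_alive_geometric n : a n <= (1 - s) ^+ n.
Proof.
pose f k : R := (0 < k < N)%N%:R.
have fb : vanishing_at_barriers N f by split; rewrite /f ltnn ?andbF.
have aE k : a k = alive_mean P X k f.
  transitivity (alive_mean P X k (fun=> 1)); last first.
    by apply: eq_alive_mean => j jN; rewrite /f jN.
  apply: eq_bigr => x _; have [ax|] := boolP (absorbed x).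
    by rewrite alive_law_absorbed // mul0r.
  by rewrite /absorbed /lift_position; case: x.2; rewrite ?mulr1.
elim: n => [|n IHn].
  rewrite aE (alive_mean0 walkX fb) expr0 /f.
  by case: (_ && _); rewrite ?ler01.
rewrite exprS; apply: (@le_trans _ _ ((1 - s) * a n)); last first.
  by rewrite ler_wpM2l //; move: p_gt0 q_gt0 r_ge0 pqrs1 => *; lra.
rewrite aE (alive_meanS walkX) // mulr_sumr; apply: ler_sum => x _.
rewrite [leRHS]mulrC ler_wpM2l ?alive_law_ge0 // /lift_position.
have -> : 1 - s = p + q + r by rewrite -pqrs1; ring.
case: ifP => _; first by rewrite !addr_ge0 ?(ltW p_gt0) ?(ltW q_gt0).
have f01 k : f k <= 1 by rewrite /f; case: (_ && _).
by rewrite !lerD ?ler_piMr ?f01 ?(ltW p_gt0) ?(ltW q_gt0).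
Qed.

(** Time already spent plus expected time left balance: each step replaces the
    mean of m by the same mean minus the probability of being alive, so the
    sum telescopes. *)
Lemma sum_prob_alive n :
  \sum_(0 <= k < n) a k = m i - alive_mean P X n m.
Proof.
have mb : vanishing_at_barriers N m by split; [exact: mean_time0|exact: mean_timeN].
elim: n => [|n IHn]; first by rewrite big_geq // (alive_mean0 walkX mb) subrr.
rewrite big_nat_recr //= IHn (alive_meanS walkX) //.
rewrite [in RHS](eq_alive_mean _ _ _ (g := fun k => m k - 1)); last first.
  by move=> k kN; exact: mean_time_first_step.
have -> : alive_mean P X n (fun k => m k - 1) = alive_mean P X n m - a n.
  rewrite -sumrB; apply: eq_bigr => x _.
  have [ax|] := boolP (absorbed x).
    by rewrite alive_law_absorbed // !mul0r subr0.
  by rewrite /absorbed /lift_position; case: x.2 => //= _; rewrite mulrBr mulr1.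
ring.
Qed.

Lemma alive_mean_cvg0 (f : nat -> R) : alive_mean P X n f @[n --> \oo] --> 0.
Proof.
pose C := \sum_(x : state N) `|lift_position f x|.
have bound n : `|alive_mean P X n f| <= geometric C (1 - s) n.
  apply: (le_trans (ler_norm_sum _ _ _)); rewrite /geometric /=.
  apply: (@le_trans _ _ (C * a n)); last first.
    by rewrite ler_wpM2l ?prob_alive_geometric // sumr_ge0.
  rewrite mulr_sumr; apply: ler_sum => x _.
  rewrite normrM (ger0_norm (alive_law_ge0 _ _ _ _)) mulrC ler_wpM2r ?alive_law_ge0 //.
  by rewrite /C (bigD1 x) //= lerDl sumr_ge0.
have s1 : `|1 - s| < 1.
  by rewrite ltr_norml; move: p_gt0 q_gt0 s_gt0 r_ge0 pqrs1 => *; lra.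
have g0 := cvg_geometric C s1.
apply/cvgr0Pnorm_le => e e0; move/cvgr0Pnorm_le: g0 => /(_ e e0).
apply: filterS => n; apply: le_trans.
by apply: (le_trans (bound n)); exact: ler_norm.
Qed.

Lemma expected_absorption_timeE :
  expected_absorption_time P X = (m i)%:E.
Proof.
rewrite /expected_absorption_time.
under eq_integral do rewrite absorption_time_series.
have mA n : measurable (alive_through X n) by exact: measurable_alive walkX n.
rewrite integral_nneseries //; last first.
  by move=> n; apply/measurable_EFinP; exact: measurable_indic.
apply/cvg_lim => //.
rewrite (_ : (fun n => _) = EFin \o (fun n => m i - alive_mean P X n m)); last first.
  apply/funext => n /=; rewrite -sum_prob_alive -sumEFin; apply: eq_bigr => k _.
  rewrite integral_indic // setIT; exact: (prob_alive walkX).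
apply: cvg_EFin; first exact: nearW.
rewrite -[X in _ --> X]subr0; apply: cvgB; first exact: cvg_cst.
exact: alive_mean_cvg0.
Qed.

End ExpectedTime.

Theorem theorem10 (R : realType) (p q r s : R)
    (p_gt0 : 0 < p) (q_gt0 : 0 < q) (s_gt0 : 0 < s) (r_ge0 : 0 <= r)
    (pqrs1 : p + q + r + s = 1)
    (N : nat) (N_ge1 : (1 <= N)%N) (i : 'I_N.+1)
    (d : measure_display) (T : measurableType d) (P : probability T R)
    (X : nat -> T -> state N) (walkX : pqrs_walk p q r s i P X) :
  let x1 := xi1 p q r in
  let x2 := xi2 p q r in
  expected_absorption_time P X =
  (s^-1 * (((1 - x1 ^+ (N - i)) * (1 - x2 ^+ N)
            - (1 - x2 ^+ (N - i)) * (1 - x1 ^+ N))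
           / (x1 ^+ N - x2 ^+ N)))%:E.
Proof.
exact: (expected_absorption_timeE p_gt0 q_gt0 s_gt0 r_ge0 pqrs1 walkX).
Qed.
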